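(* Let $s$ be an integer and $\alpha=(1+\sqrt5)/2$. Then \[ \sum_{j = 1}^\infty \frac{F_{2j + s}}{\binom{2j}j} = \frac{L_{s + 3}}{5} + (L_{s + 2} \sqrt 5 - L_s )\frac{2\pi }{25}\sqrt {\frac{\alpha ^3 }{\sqrt 5 }}, \qquad \sum_{j = 1}^\infty \frac{L_{2j + s}}{\binom{2j}j} = F_{s + 3} + (F_{s + 2} \sqrt 5 - F_s )\frac{2\pi }{5}\sqrt {\frac{\alpha ^3 }{\sqrt 5 }}. \]
   Context: $F_j$ and $L_j$ denote the Fibonacci and Lucas numbers, defined for all integers $j$ by $F_0=0$, $F_1=1$, $L_0=2$, $L_1=1$, $F_j=F_{j-1}+F_{j-2}$, $L_j=L_{j-1}+L_{j-2}$, extended to negative indices by $F_{-j}=(-1)^{j-1}F_j$, $L_{-j}=(-1)^jL_j$; equivalently $F_j=(\alpha^j-\beta^j)/\sqrt5$, $L_j=\alpha^j+\beta^j$ with $\beta=(1-\sqrt5)/2$. *)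

(* Defs.v *)
From Stdlib Require Import Reals ZArith Lia.
From Coquelicot Require Import Coquelicot.

Fixpoint fib (n : nat) : Z :=
  match n with
  | O => 0
  | S O => 1
  | S (S m as k) => fib k + fib m
  end%Z.

Fixpoint lucas (n : nat) : Z :=
  match n with
  | O => 2
  | S O => 1
  | S (S m as k) => lucas k + lucas m
  end%Z.

(* Extension to all integers by F_{-j} = (-1)^(j-1) F_j and L_{-j} = (-1)^j L_j. *)
Definition fibZ (j : Z) : Z :=
  match j with
  | Z0 => fib 0
  | Zpos p => fib (Pos.to_nat p)
  | Zneg p => (-1) ^ (Zpos p - 1) * fib (Pos.to_nat p)
  end%Z.

Definition lucasZ (j : Z) : Z :=
  match j with
  | Z0 => lucas 0
  | Zpos p => lucas (Pos.to_nat p)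
  | Zneg p => (-1) ^ Zpos p * lucas (Pos.to_nat p)
  end%Z.

Definition alpha : R := ((1 + sqrt 5) / 2)%R.

Lemma fibZ_of_nat n : fibZ (Z.of_nat n) = fib n.
Proof. destruct n; [easy|]. simpl. now rewrite SuccNat2Pos.id_succ. Qed.

Lemma lucasZ_of_nat n : lucasZ (Z.of_nat n) = lucas n.
Proof. destruct n; [easy|]. simpl. now rewrite SuccNat2Pos.id_succ. Qed.

Lemma fibZ_opp_nat n : fibZ (- Z.of_nat n) = (- (-1) ^ Z.of_nat n * fib n)%Z.
Proof.
destruct n; [easy|].
replace (- Z.of_nat (S n))%Z with (Zneg (Pos.of_succ_nat n)) by reflexivity.
unfold fibZ; rewrite SuccNat2Pos.id_succ.
replace (Zpos (Pos.of_succ_nat n) - 1)%Z with (Z.of_nat n) by lia.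
rewrite Nat2Z.inj_succ, Z.pow_succ_r by lia. ring.
Qed.

Lemma lucasZ_opp_nat n : lucasZ (- Z.of_nat n) = ((-1) ^ Z.of_nat n * lucas n)%Z.
Proof.
destruct n; [easy|].
replace (- Z.of_nat (S n))%Z with (Zneg (Pos.of_succ_nat n)) by reflexivity.
unfold lucasZ; rewrite SuccNat2Pos.id_succ.
now replace (Zpos (Pos.of_succ_nat n)) with (Z.of_nat (S n)) by lia.
Qed.

Lemma fib_SS n : fib (S (S n)) = (fib (S n) + fib n)%Z.
Proof. reflexivity. Qed.

Lemma lucas_SS n : lucas (S (S n)) = (lucas (S n) + lucas n)%Z.
Proof. reflexivity. Qed.

Lemma Z_rec_cases (j : Z) :
  (exists n, j = Z.of_nat (S (S n))) \/ j = 1%Z \/ exists n, j = (- Z.of_nat n)%Z.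
Proof.
destruct (Z_le_gt_dec 2 j).
- left; exists (Z.to_nat (j - 2)); lia.
- destruct (Z.eq_dec j 1); [now right; left|].
  right; right; exists (Z.to_nat (- j)); lia.
Qed.

Lemma fibZ_rec j : fibZ j = (fibZ (j - 1) + fibZ (j - 2))%Z.
Proof.
destruct (Z_rec_cases j) as [[n ->]|[->|[n ->]]]; [|reflexivity|].
- replace (Z.of_nat (S (S n)) - 1)%Z with (Z.of_nat (S n)) by lia.
  replace (Z.of_nat (S (S n)) - 2)%Z with (Z.of_nat n) by lia.
  rewrite !fibZ_of_nat; apply fib_SS.
- replace (- Z.of_nat n - 1)%Z with (- Z.of_nat (S n))%Z by lia.
  replace (- Z.of_nat n - 2)%Z with (- Z.of_nat (S (S n)))%Z by lia.
  rewrite !fibZ_opp_nat, fib_SS, !Nat2Z.inj_succ, !Z.pow_succ_r by lia. ring.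
Qed.

Lemma lucasZ_rec j : lucasZ j = (lucasZ (j - 1) + lucasZ (j - 2))%Z.
Proof.
destruct (Z_rec_cases j) as [[n ->]|[->|[n ->]]]; [|reflexivity|].
- replace (Z.of_nat (S (S n)) - 1)%Z with (Z.of_nat (S n)) by lia.
  replace (Z.of_nat (S (S n)) - 2)%Z with (Z.of_nat n) by lia.
  rewrite !lucasZ_of_nat; apply lucas_SS.
- replace (- Z.of_nat n - 1)%Z with (- Z.of_nat (S n))%Z by lia.
  replace (- Z.of_nat n - 2)%Z with (- Z.of_nat (S (S n)))%Z by lia.
  rewrite !lucasZ_opp_nat, lucas_SS, !Nat2Z.inj_succ, !Z.pow_succ_r by lia. ring.
Qed.

(* [is_series] sums over n >= 0; a sum over j >= 1 has general term [a (S n)]. *)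
Definition is_series1 (a : nat -> R) (l : R) : Prop :=
  is_series (fun n => a (S n)) l.

(* Main.v *)
Require Import Defs.
From Stdlib Require Import Reals ZArith Lra Lia.
From Coquelicot Require Import Coquelicot.
Open Scope R_scope.

(** The power series [g x = sum_n (4 x)^n / ((2n+1) C(2n,n))] and
    [G x = sum_n (4 x)^n / C(2n,n) = g x + 2 x g' x] satisfy
    [(1 - x) G x = 1 + x g x].  Hence [sin t cos t g(sin^2 t)] has derivative [1],
    so it equals [t], and [G(sin^2 t) = (1 + t tan t) / cos^2 t].  By Binet's
    formulas, the theorem is the combination of the cases [t = 3 PI / 10], where
    [4 sin^2 t = alpha^2], and [t = PI / 10], where [4 sin^2 t = beta^2]. *)

(** * The power series g and G and their differential equation *)

Definition central_coef (n : nat) : R := 4 ^ n / Binomial.C (2 * n) n.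

Definition arcsin_coef (n : nat) : R := central_coef n / (2 * INR n + 1).

Lemma central_binomial_pos n : 0 < Binomial.C (2 * n) n.
Proof.
unfold Binomial.C; apply Rdiv_lt_0_compat; [|apply Rmult_lt_0_compat];
  apply INR_fact_lt_0.
Qed.

Lemma central_binomial_succ n :
  Binomial.C (2 * S n) (S n) * (INR n + 1) = 2 * (2 * INR n + 1) * Binomial.C (2 * n) n.
Proof.
unfold Binomial.C.
replace (2 * S n)%nat with (S (S (2 * n))) by lia.
replace (S (S (2 * n)) - S n)%nat with (S n) by lia.
replace (2 * n - n)%nat with n by lia.
rewrite !fact_simpl, !mult_INR, !S_INR, mult_INR.
replace (INR 2) with 2 by (simpl; ring).
pose proof (INR_fact_neq_0 n); pose proof (pos_INR n).
field; repeat split; (assumption || lra).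
Qed.

Lemma central_coef_0 : central_coef 0 = 1.
Proof. unfold central_coef, Binomial.C; simpl; field. Qed.

Lemma central_coef_pos n : 0 < central_coef n.
Proof.
apply Rdiv_lt_0_compat; [apply pow_lt; lra | apply central_binomial_pos].
Qed.

(** With [central_coef_arcsin_coef] this gives [central_coef (S n) = central_coef n + arcsin_coef
    n], the coefficient form of the differential equation. *)
Lemma central_coef_succ n :
  central_coef (S n) = (2 * INR n + 2) * arcsin_coef n.
Proof.
unfold arcsin_coef, central_coef.
pose proof (central_binomial_succ n) as H.
pose proof (central_binomial_pos n); pose proof (central_binomial_pos (S n)).
pose proof (pos_INR n).
replace (Binomial.C (2 * S n) (S n))
  with (2 * (2 * INR n + 1) * Binomial.C (2 * n) n / (INR n + 1))
  by (rewrite <- H; field; lra).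
simpl pow; field; lra.
Qed.

Lemma central_coef_arcsin_coef n :
  central_coef n = (2 * INR n + 1) * arcsin_coef n.
Proof. unfold arcsin_coef; pose proof (pos_INR n); field; lra. Qed.

Lemma arcsin_coef_pos n : 0 < arcsin_coef n.
Proof.
apply Rdiv_lt_0_compat; [apply central_coef_pos | pose proof (pos_INR n); lra].
Qed.

(** Ratio test: consecutive coefficients have quotient (2n+2)/(2n+3) = 1 - 1/(2n+3), which tends to
    1. *)
Lemma CV_radius_arcsin_coef : CV_radius arcsin_coef = 1.
Proof.
rewrite <- Rinv_1 at 1.
apply CV_radius_finite_DAlembert; [|lra|].
- intros n; apply Rgt_not_eq, arcsin_coef_pos.
- apply is_lim_seq_ext with (fun n => 1 - / (2 * INR n + 3)).
  + intros n; pose proof (pos_INR n); pose proof (arcsin_coef_pos n).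
    unfold arcsin_coef at 1; rewrite central_coef_succ, S_INR.
    rewrite Rabs_pos_eq.
    * field; lra.
    * apply Rlt_le, Rdiv_lt_0_compat; [|easy].
      apply Rdiv_lt_0_compat; [apply Rmult_lt_0_compat|]; lra.
  + replace (Finite 1) with (Finite (1 - 0)) by (f_equal; ring).
    apply is_lim_seq_minus'; [apply is_lim_seq_const|].
    apply (is_lim_seq_inv _ p_infty); [|easy].
    apply is_lim_seq_le_p_loc with INR; [|apply is_lim_seq_INR].
    exists 0%nat; intros n _; pose proof (pos_INR n); lra.
Qed.

Lemma is_series_central_coef x : Rabs x < 1 ->
  is_series (fun n => central_coef n * x ^ n)
    (PSeries arcsin_coef x + 2 * x * PSeries (PS_derive arcsin_coef) x).
Proof.
intros Hx.
assert (Hg : is_series (fun n => arcsin_coef n * x ^ n) (PSeries arcsin_coef x)).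
{ apply is_pseries_R, PSeries_correct, CV_radius_inside.
  now rewrite CV_radius_arcsin_coef. }
assert (Hd : is_series (fun n => PS_derive arcsin_coef n * x ^ n)
               (PSeries (PS_derive arcsin_coef) x)).
{ apply is_pseries_R, PSeries_correct, CV_radius_inside.
  now rewrite CV_radius_derive, CV_radius_arcsin_coef. }
assert (Hd' : is_series (fun n => 2 * INR n * arcsin_coef n * x ^ n)
                (2 * x * PSeries (PS_derive arcsin_coef) x)).
{ apply is_series_decr_1.
  match goal with |- is_series _ ?l =>
    replace l with (scal (2 * x) (PSeries (PS_derive arcsin_coef) x)) end.
  - eapply is_series_ext; [|apply (is_series_scal (2 * x) _ _ Hd)].
    intros n; unfold PS_derive, scal; cbn -[INR]; unfold mult; cbn -[INR]; ring.
  - unfold scal, plus, opp; simpl; unfold mult; simpl; ring. }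
eapply is_series_ext; [|apply (is_series_plus _ _ _ _ Hg Hd')].
intros n; rewrite central_coef_arcsin_coef; unfold plus; simpl; ring.
Qed.

(** The tail of G from index 1 is summed in two ways: it is G - 1, and by the coefficient recurrence
    it is x (G + g). *)
Lemma arcsin_PSeries_ode x : Rabs x < 1 ->
  (1 - x) * (PSeries arcsin_coef x + 2 * x * PSeries (PS_derive arcsin_coef) x)
  = 1 + x * PSeries arcsin_coef x.
Proof.
intros Hx.
pose proof (is_series_central_coef x Hx) as HG.
set (G := PSeries arcsin_coef x + _) in *.
assert (Hg : is_series (fun n => arcsin_coef n * x ^ n) (PSeries arcsin_coef x)).
{ apply is_pseries_R, PSeries_correct, CV_radius_inside.
  now rewrite CV_radius_arcsin_coef. }
pose proof (is_series_scal x _ _ (is_series_plus _ _ _ _ HG Hg)) as H1.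
pose proof (is_series_incr_1 (fun n => central_coef n * x ^ n) (G - 1)) as H2.
assert (H3 : is_series (fun n => central_coef (S n) * x ^ S n) (G - 1)).
{ apply H2; rewrite central_coef_0.
  match goal with |- is_series _ ?l => replace l with G; [exact HG|] end.
  unfold plus; simpl; ring. }
assert (H4 : is_series (fun n => central_coef (S n) * x ^ S n)
               (scal x (plus G (PSeries arcsin_coef x)))).
{ eapply is_series_ext; [|apply H1].
  intros n; rewrite central_coef_succ, central_coef_arcsin_coef.
  unfold scal, plus; simpl; unfold mult; simpl; ring. }
apply is_series_unique in H3; apply is_series_unique in H4.
rewrite H3 in H4; unfold scal, plus in H4; simpl in H4; unfold mult in H4; simpl in H4.
lra.
Qed.

(** * Closed form of the series at the square of a sine *)

Lemma Rabs_sin_sqr_lt_1 t : 0 < cos t -> Rabs (sin t ^ 2) < 1.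
Proof.
intros Hc; pose proof (sin2_cos2 t) as H; unfold Rsqr in H.
rewrite Rabs_pos_eq; nra.
Qed.

Lemma arcsin_PSeries_sin t : 0 <= t < PI / 2 ->
  sin t * cos t * PSeries arcsin_coef (sin t ^ 2) = t.
Proof.
intros Ht.
(* The function vanishes at 0, so a zero derivative on the interval forces it to vanish at [t]. *)
destruct (MVT_gen (fun u => sin u * cos u * PSeries arcsin_coef (sin u ^ 2) - u)
            0 t (fun _ => 0)) as [c [_ Hc]].
- intros u Hu; rewrite Rmin_left, Rmax_right in Hu by lra.
  assert (Hcos : 0 < cos u) by (apply cos_gt_0; lra).
  pose proof (Rabs_sin_sqr_lt_1 u Hcos) as Hx.
  pose proof (arcsin_PSeries_ode _ Hx) as Hode.
  pose proof (sin2_cos2 u) as Hsc; unfold Rsqr in Hsc.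
  assert (Hd : is_derive (PSeries arcsin_coef) (sin u ^ 2)
                 (PSeries (PS_derive arcsin_coef) (sin u ^ 2))).
  { apply is_derive_PSeries; now rewrite CV_radius_arcsin_coef. }
  auto_derive.
  + repeat split; eexists; exact Hd.
  + replace (sin u * (sin u * 1)) with (sin u ^ 2) by ring.
    change (fun x : R => PSeries arcsin_coef x) with (PSeries arcsin_coef).
    rewrite (is_derive_unique _ _ _ Hd).
    set (g := PSeries arcsin_coef _) in *.
    set (g' := PSeries (PS_derive arcsin_coef) _) in *.
    (* The derivative of the product is (cos^2 - sin^2) g + 2 sin^2 cos^2 g', which the differential
       equation at sin^2 u makes equal to 1. *)
    replace (1 - sin u ^ 2) with (cos u * cos u) in Hode by (rewrite <- Hsc; ring).
    lra.
- intros u Hu; rewrite Rmin_left, Rmax_right in Hu by lra.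
  assert (Hcos : 0 < cos u) by (apply cos_gt_0; lra).
  pose proof (Rabs_sin_sqr_lt_1 u Hcos) as Hx.
  apply continuity_pt_filterlim.
  apply (ex_derive_continuous
    (fun v => sin v * cos v * PSeries arcsin_coef (sin v ^ 2) - v) u).
  auto_derive.
  repeat split; eexists; apply is_derive_PSeries; now rewrite CV_radius_arcsin_coef.
- rewrite sin_0 in Hc; lra.
Qed.

Lemma is_series_inv_central_binomial t : 0 < t < PI / 2 ->
  is_series (fun n => (4 * sin t ^ 2) ^ n / Binomial.C (2 * n) n)
    ((1 + t * tan t) / cos t ^ 2).
Proof.
intros Ht.
assert (Hcos : 0 < cos t) by (apply cos_gt_0; lra).
assert (Hsin : 0 < sin t) by (apply sin_gt_0; lra).
pose proof (Rabs_sin_sqr_lt_1 t Hcos) as Hx.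
pose proof (is_series_central_coef _ Hx) as HG.
pose proof (arcsin_PSeries_ode _ Hx) as Hode.
pose proof (arcsin_PSeries_sin t ltac:(lra)) as Hg.
pose proof (sin2_cos2 t) as Hsc; unfold Rsqr in Hsc.
replace ((1 + t * tan t) / cos t ^ 2)
  with (PSeries arcsin_coef (sin t ^ 2)
        + 2 * sin t ^ 2 * PSeries (PS_derive arcsin_coef) (sin t ^ 2)).
- refine (is_series_ext _ _ _ _ HG); intros n.
  unfold central_coef, Rdiv; rewrite Rpow_mult_distr.
  match goal with |- ?a = ?b => change (@eq R a b) end; ring.
(* Multiplied by cos^2 t = 1 - sin^2 t, the sum becomes the left side of the differential equation,
   where g = t / (sin t cos t). *)
- apply Rmult_eq_reg_l with (cos t ^ 2); [|apply pow_nonzero; lra].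
  replace (cos t ^ 2) with (1 - sin t ^ 2) at 1 by (rewrite <- Hsc; ring).
  replace (PSeries arcsin_coef (sin t ^ 2)) with (t / (sin t * cos t)) in Hode |- *
    by (rewrite <- Hg at 1; field; lra).
  rewrite Hode; unfold tan; field; lra.
Qed.

(** * Sines and tangents of PI / 10 and 3 PI / 10 *)

Definition beta : R := (1 - sqrt 5) / 2.

Lemma sqrt5_sqr : sqrt 5 * sqrt 5 = 5.
Proof. apply sqrt_sqrt; lra. Qed.

Lemma sqrt5_cube : sqrt 5 ^ 3 = 5 * sqrt 5.
Proof. rewrite <- sqrt5_sqr at 2; ring. Qed.

Lemma sqrt5_bounds : 2 < sqrt 5 < 3.
Proof. pose proof sqrt5_sqr; pose proof (sqrt_pos 5); nra. Qed.

(** For x = PI / 10, 5x = PI / 2 gives sin 3x = cos 2x, a cubic in u = sin x that factors as (1 -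
    u)(4u^2 + 2u - 1) = 0. *)
Lemma sin_PI10 : sin (PI / 10) = (sqrt 5 - 1) / 4.
Proof.
set (u := sin (PI / 10)).
pose proof PI_RGT_0.
assert (Hu : 0 < u) by (apply sin_gt_0; lra).
assert (Hc : 0 < cos (PI / 10)) by (apply cos_gt_0; lra).
pose proof (sin2_cos2 (PI / 10)) as Hsc; unfold Rsqr in Hsc; fold u in Hsc.
assert (H3 : sin (2 * (PI / 10) + PI / 10) = cos (2 * (PI / 10))).
{ rewrite <- sin_shift; f_equal; field. }
rewrite sin_plus, sin_2a, cos_2a in H3; fold u in H3.
set (c := cos (PI / 10)) in *.
replace (2 * u * c * c) with (2 * u * (1 - u * u)) in H3 by (rewrite <- Hsc; ring).
replace (c * c) with (1 - u * u) in H3 by (rewrite <- Hsc; ring).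
assert (Hf : (1 - u) * (4 * (u * u) + 2 * u - 1) = 0) by lra.
assert (Hq : 4 * (u * u) + 2 * u - 1 = 0).
(* The root u = 1 would make the cosine zero. *)
{ apply Rmult_integral in Hf; destruct Hf; [nra | easy]. }
pose proof sqrt5_sqr; pose proof sqrt5_bounds.
assert (H5 : (4 * u + 1 - sqrt 5) * (4 * u + 1 + sqrt 5) = 0) by nra.
apply Rmult_integral in H5; destruct H5; lra.
Qed.

Lemma sin_3PI10 : sin (3 * PI / 10) = (sqrt 5 + 1) / 4.
Proof.
replace (3 * PI / 10) with (PI / 2 - 2 * (PI / 10)) by field.
rewrite sin_shift, cos_2a_sin, sin_PI10.
pose proof sqrt5_sqr; lra.
Qed.

(** In the first quadrant the tangent is the nonnegative root of sin^2 / (1 - sin^2); this avoids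
    the nested radical of the cosine. *)
Lemma tan_eq_of_sqr t y : 0 < t < PI / 2 -> 0 <= y ->
  sin t ^ 2 = y ^ 2 * (1 - sin t ^ 2) -> tan t = y.
Proof.
intros Ht Hy H.
assert (Hcos : 0 < cos t) by (apply cos_gt_0; lra).
assert (Hsin : 0 < sin t) by (apply sin_gt_0; lra).
pose proof (sin2_cos2 t) as Hsc; unfold Rsqr in Hsc.
replace (1 - sin t ^ 2) with (cos t ^ 2) in H by (rewrite <- Hsc; ring).
assert (Hs : sin t = y * cos t).
{ apply Rsqr_inj; [lra | nra |]; unfold Rsqr; lra. }
unfold tan; rewrite Hs; field; lra.
Qed.

Lemma alpha_cube : alpha ^ 3 = sqrt 5 + 2.
Proof. unfold alpha; pose proof sqrt5_sqr; pose proof sqrt5_cube; lra. Qed.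

Lemma sqr_sqrt_alpha_cube_div : sqrt (alpha ^ 3 / sqrt 5) ^ 2 = (5 + 2 * sqrt 5) / 5.
Proof.
pose proof sqrt5_sqr as H; pose proof sqrt5_bounds.
rewrite pow2_sqrt; rewrite alpha_cube.
- transitivity ((sqrt 5 + 2) * sqrt 5 / (sqrt 5 * sqrt 5)); [field; lra|].
  rewrite H; lra.
- apply Rlt_le, Rdiv_lt_0_compat; lra.
Qed.

Lemma tan_3PI10 : tan (3 * PI / 10) = sqrt (alpha ^ 3 / sqrt 5).
Proof.
pose proof PI_RGT_0; pose proof sqrt5_sqr.
apply tan_eq_of_sqr; [lra | apply sqrt_pos |].
pose proof sqrt5_cube; rewrite sqr_sqrt_alpha_cube_div, sin_3PI10; lra.
Qed.

(** The factor [sqrt 5 - 2] is the inverse of [alpha ^ 3]. This form shares its radical with tan (3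
    PI / 10), so that the two series can be combined. *)
Lemma tan_PI10 : tan (PI / 10) = sqrt (alpha ^ 3 / sqrt 5) * (sqrt 5 - 2).
Proof.
pose proof PI_RGT_0; pose proof sqrt5_sqr; pose proof sqrt5_bounds.
apply tan_eq_of_sqr; [lra | apply Rmult_le_pos; [apply sqrt_pos | lra] |].
rewrite Rpow_mult_distr, sqr_sqrt_alpha_cube_div, sin_PI10.
replace ((sqrt 5 - 2) ^ 2) with (9 - 4 * sqrt 5) by lra.
replace ((5 + 2 * sqrt 5) / 5 * (9 - 4 * sqrt 5)) with (1 - 2 * sqrt 5 / 5) by lra.
pose proof sqrt5_cube; lra.
Qed.

Lemma cos_sqr t : cos t ^ 2 = 1 - sin t ^ 2.
Proof. pose proof (sin2_cos2 t) as H; unfold Rsqr in H; lra. Qed.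

(** * The series at the squares of alpha and beta *)

(** Here t = 3 PI / 10: the factor [2 + 2 * sqrt 5 / 5] is 1 / cos^2 t, and the final [- 1] removes
    the term of index 0. *)
Lemma is_series1_alpha :
  is_series1 (fun j => (alpha ^ 2) ^ j / Binomial.C (2 * j) j)
    ((1 + 3 * PI / 10 * sqrt (alpha ^ 3 / sqrt 5)) * (2 + 2 * sqrt 5 / 5) - 1).
Proof.
pose proof PI_RGT_0; pose proof sqrt5_sqr as Hw; pose proof sqrt5_bounds.
assert (H1 := is_series_inv_central_binomial (3 * PI / 10) ltac:(lra)).
rewrite cos_sqr, tan_3PI10, sin_3PI10 in H1.
replace (4 * ((sqrt 5 + 1) / 4) ^ 2) with (alpha ^ 2) in H1 by (unfold alpha; field).
unfold is_series1; apply (is_series_incr_1 (fun j => (alpha ^ 2) ^ j / Binomial.C (2 * j) j)).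
match type of H1 with is_series _ ?l => match goal with |- is_series _ ?l' =>
  replace l' with l; [exact H1|] end end.
unfold plus, Binomial.C; simpl.
replace (1 - (sqrt 5 + 1) / 4 * ((sqrt 5 + 1) / 4 * 1)) with ((5 - sqrt 5) / 8) by nra.
apply Rmult_eq_reg_r with ((5 - sqrt 5) / 8); [|lra].
(* The radical occurs linearly on both sides, so it can be treated as an indeterminate. *)
set (q := sqrt (_ / _)).
field_simplify; [|lra..].
replace (sqrt 5 ^ 2) with 5 by (simpl; lra); field.
Qed.

(** Here t = PI / 10, with 1 / cos^2 t equal to [2 - 2 * sqrt 5 / 5]. *)
Lemma is_series1_beta :
  is_series1 (fun j => (beta ^ 2) ^ j / Binomial.C (2 * j) j)
    ((1 + PI / 10 * (sqrt (alpha ^ 3 / sqrt 5) * (sqrt 5 - 2))) * (2 - 2 * sqrt 5 / 5) - 1).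
Proof.
pose proof PI_RGT_0; pose proof sqrt5_sqr as Hw; pose proof sqrt5_bounds.
assert (H1 := is_series_inv_central_binomial (PI / 10) ltac:(lra)).
rewrite cos_sqr, tan_PI10, sin_PI10 in H1.
replace (4 * ((sqrt 5 - 1) / 4) ^ 2) with (beta ^ 2) in H1 by (unfold beta; field).
unfold is_series1; apply (is_series_incr_1 (fun j => (beta ^ 2) ^ j / Binomial.C (2 * j) j)).
match type of H1 with is_series _ ?l => match goal with |- is_series _ ?l' =>
  replace l' with l; [exact H1|] end end.
unfold plus, Binomial.C; simpl.
replace (1 - (sqrt 5 - 1) / 4 * ((sqrt 5 - 1) / 4 * 1)) with ((5 + sqrt 5) / 8) by nra.
apply Rmult_eq_reg_r with ((5 + sqrt 5) / 8); [|lra].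
set (q := sqrt (_ / _)).
field_simplify; [|lra..].
rewrite ?sqrt5_cube.
replace (sqrt 5 ^ 2) with 5 by (simpl; lra); field.
Qed.

(** * Binet's formulas for integer indices *)

(** Induction in both directions from 0, carrying agreement at two consecutive indices. *)
Lemma fibonacci_recurrence_unique (u v : Z -> R) :
  (forall j, u j = u (j - 1)%Z + u (j - 2)%Z) ->
  (forall j, v j = v (j - 1)%Z + v (j - 2)%Z) ->
  u 0%Z = v 0%Z -> u 1%Z = v 1%Z -> forall j, u j = v j.
Proof.
intros Hu Hv H0 H1 j.
enough (u j = v j /\ u (j + 1)%Z = v (j + 1)%Z) by easy.
induction j as [|j [IH1 IH2]|j [IH1 IH2]] using Z.peano_ind.
- easy.
- unfold Z.succ; split; [easy|].
  rewrite Hu, Hv.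
  replace (j + 1 + 1 - 1)%Z with (j + 1)%Z by ring.
  replace (j + 1 + 1 - 2)%Z with j by ring; lra.
- unfold Z.pred; replace (j + -1 + 1)%Z with j by ring; split; [|easy].
  (* Downwards, the recurrence at j + 1 is solved for its oldest term, of index j - 1. *)
  pose proof (Hu (j + 1)%Z) as Eu; pose proof (Hv (j + 1)%Z) as Ev.
  replace (j + 1 - 1)%Z with j in Eu, Ev by ring.
  replace (j + 1 - 2)%Z with (j + -1)%Z in Eu, Ev by ring; lra.
Qed.

Lemma powerRZ_fibonacci_recurrence x : x <> 0 -> x ^ 2 = x + 1 ->
  forall j, powerRZ x j = powerRZ x (j - 1) + powerRZ x (j - 2).
Proof.
intros Hx H j.
replace (powerRZ x j) with (powerRZ x (j - 2) * x ^ 2).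
- replace (powerRZ x (j - 1)) with (powerRZ x (j - 2) * x); [rewrite H; ring|].
  rewrite <- (powerRZ_1 x) at 2; rewrite <- powerRZ_add by easy; f_equal; ring.
- rewrite (pow_powerRZ x 2), <- powerRZ_add by easy; f_equal; simpl; ring.
Qed.

Lemma alpha_neq_0 : alpha <> 0.
Proof. unfold alpha; pose proof sqrt5_bounds; lra. Qed.

Lemma beta_neq_0 : beta <> 0.
Proof. unfold beta; pose proof sqrt5_bounds; lra. Qed.

Lemma alpha_sqr : alpha ^ 2 = alpha + 1.
Proof. unfold alpha; pose proof sqrt5_sqr; lra. Qed.

Lemma beta_sqr : beta ^ 2 = beta + 1.
Proof. unfold beta; pose proof sqrt5_sqr; lra. Qed.

Lemma fibZ_Binet j : IZR (fibZ j) = (powerRZ alpha j - powerRZ beta j) / sqrt 5.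
Proof.
pose proof sqrt5_bounds.
revert j; apply (fibonacci_recurrence_unique (fun j => IZR (fibZ j))
  (fun j => (powerRZ alpha j - powerRZ beta j) / sqrt 5)).
- intros j; rewrite fibZ_rec, plus_IZR; reflexivity.
- intros j.
  rewrite (powerRZ_fibonacci_recurrence alpha alpha_neq_0 alpha_sqr j).
  rewrite (powerRZ_fibonacci_recurrence beta beta_neq_0 beta_sqr j); field; lra.
- simpl; field; lra.
- simpl; unfold alpha, beta; field; lra.
Qed.

Lemma lucasZ_Binet j : IZR (lucasZ j) = powerRZ alpha j + powerRZ beta j.
Proof.
revert j; apply (fibonacci_recurrence_unique (fun j => IZR (lucasZ j))
  (fun j => powerRZ alpha j + powerRZ beta j)).
- intros j; rewrite lucasZ_rec, plus_IZR; reflexivity.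
- intros j.
  rewrite (powerRZ_fibonacci_recurrence alpha alpha_neq_0 alpha_sqr j).
  rewrite (powerRZ_fibonacci_recurrence beta beta_neq_0 beta_sqr j); ring.
- simpl; ring.
- simpl; unfold alpha, beta; field.
Qed.

(** * Combining the two series *)

Lemma powerRZ_shift_pow x s k : x <> 0 ->
  powerRZ x (s + Z.of_nat k) = powerRZ x s * x ^ k.
Proof. intros Hx; rewrite powerRZ_add, <- pow_powerRZ by easy; ring. Qed.

Lemma powerRZ_double_shift x s j : x <> 0 ->
  powerRZ x (2 * Z.of_nat j + s) = powerRZ x s * (x ^ 2) ^ j.
Proof.
intros Hx; rewrite <- pow_mult, <- powerRZ_shift_pow by easy; f_equal; lia.
Qed.

Lemma is_series1_lincomb (a b : nat -> R) (la lb x y : R) :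
  is_series1 a la -> is_series1 b lb ->
  is_series1 (fun j => x * a j + y * b j) (x * la + y * lb).
Proof.
intros Ha Hb.
exact (is_series_plus _ _ _ _ (is_series_scal x _ _ Ha) (is_series_scal y _ _ Hb)).
Qed.

Lemma is_series1_ext (a b : nat -> R) (la lb : R) :
  (forall j, a j = b j) -> la = lb -> is_series1 a la -> is_series1 b lb.
Proof. intros H <-; apply is_series_ext; intros n; apply H. Qed.

Theorem theorem7 (s : Z) :
  is_series1 (fun j : nat => IZR (fibZ (2 * Z.of_nat j + s)) / Binomial.C (2 * j) j)
    (IZR (lucasZ (s + 3)) / 5
     + (IZR (lucasZ (s + 2)) * sqrt 5 - IZR (lucasZ s))
       * (2 * PI / 25) * sqrt (alpha ^ 3 / sqrt 5))
  /\
  is_series1 (fun j : nat => IZR (lucasZ (2 * Z.of_nat j + s)) / Binomial.C (2 * j) j)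
    (IZR (fibZ (s + 3))
     + (IZR (fibZ (s + 2)) * sqrt 5 - IZR (fibZ s))
       * (2 * PI / 5) * sqrt (alpha ^ 3 / sqrt 5)).
Proof.
pose proof sqrt5_sqr as Hw; pose proof sqrt5_bounds.
pose proof is_series1_alpha as HA; pose proof is_series1_beta as HB.
pose proof (powerRZ_shift_pow alpha s 2 alpha_neq_0) as Ha2.
pose proof (powerRZ_shift_pow alpha s 3 alpha_neq_0) as Ha3.
pose proof (powerRZ_shift_pow beta s 2 beta_neq_0) as Hb2.
pose proof (powerRZ_shift_pow beta s 3 beta_neq_0) as Hb3.
simpl Z.of_nat in *.
(* All powers of alpha and beta except those of exponent s are made linear in [sqrt 5]. *)
assert (E2 : alpha ^ 2 = (3 + sqrt 5) / 2) by (unfold alpha; lra).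
assert (E2' : beta ^ 2 = (3 - sqrt 5) / 2) by (unfold beta; lra).
assert (E3' : beta ^ 3 = 2 - sqrt 5) by (pose proof sqrt5_cube; unfold beta; lra).
rewrite E2 in Ha2; rewrite alpha_cube in Ha3; rewrite E2' in Hb2; rewrite E3' in Hb3.
set (q := sqrt (alpha ^ 3 / sqrt 5)) in *.
(* With this inverse and the reductions of powers of [sqrt 5], the closed forms are compared as
   polynomials in [sqrt 5], [q], [PI] and the s-th powers of alpha and beta. *)
assert (Hi : / sqrt 5 = sqrt 5 / 5) by (rewrite <- Hw at 3; field; lra).
assert (Hw2 : sqrt 5 ^ 2 = 5) by (simpl; lra).
split.
(* The weights come from Binet: F_(2j+s) = (alpha^s (alpha^2)^j - beta^s (beta^2)^j) / sqrt 5. *)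
- eapply is_series1_ext; [| |exact (is_series1_lincomb _ _ _ _
    (powerRZ alpha s / sqrt 5) (- (powerRZ beta s / sqrt 5)) HA HB)].
  + intros j; cbv beta; rewrite fibZ_Binet.
    rewrite !powerRZ_double_shift by (apply alpha_neq_0 || apply beta_neq_0).
    field; split; [lra | apply Rgt_not_eq, central_binomial_pos].
  + rewrite !lucasZ_Binet, Ha2, Ha3, Hb2, Hb3; unfold Rdiv; rewrite Hi.
    field_simplify; rewrite ?sqrt5_cube, ?Hw2; field.
(* For Lucas numbers the weights are alpha^s and beta^s. *)
- eapply is_series1_ext; [| |exact (is_series1_lincomb _ _ _ _
    (powerRZ alpha s) (powerRZ beta s) HA HB)].
  + intros j; cbv beta; rewrite lucasZ_Binet.
    rewrite !powerRZ_double_shift by (apply alpha_neq_0 || apply beta_neq_0).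
    field; apply Rgt_not_eq, central_binomial_pos.
  + rewrite !fibZ_Binet, Ha2, Ha3, Hb2, Hb3; unfold Rdiv; rewrite Hi.
    field_simplify; rewrite ?sqrt5_cube, ?Hw2; field.
Qed.
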